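(* Let $(\varphi,\vec\xi,\eta,\tilde g)$ be a contact metric structure on a smooth manifold $X$ of odd dimension $n$, with $\omega=d\eta$ non-degenerate on $D=\ker\eta$ and $\ker\omega=\mathrm{span}(\vec\xi)$, and let $\nabla$ be the intrinsic metric connection on $D$. Then the structure is normal if and only if $\varphi$ is quasi-integrable and $\nabla\varphi=0$, i.e. $\nabla_{\vec u}(\varphi\vec v)=\varphi(\nabla_{\vec u}\vec v)$ for all sections $\vec u,\vec v$ of $D$.
   Context: All objects are $C^\infty$. An almost contact metric structure on $X$ is a tuple $(\varphi,\vec\xi,\eta,\tilde g)$, where $\varphi$ is a $(1,1)$-tensor field, $\vec\xi$ a vector field, $\eta$ a 1-form and $\tilde g$ a (pseudo-)Riemannian metric on $X$, such that $\eta(\vec\xi)=1$, $\varphi(\vec\xi)=0$, $\eta\circ\varphi=0$, $\varphi^2\vec X=-\vec X+\eta(\vec X)\vec\xi$ and $\tilde g(\varphi\vec X,\varphi\vec Y)=\tilde g(\vec X,\vec Y)-\eta(\vec X)\eta(\vec Y)$ for all vector fields $\vec X,\vec Y$. It is a contact metric structure if $\Omega=d\eta$, where $\Omega(\vec X,\vec Y)=\tilde g(\vec X,\varphi\vec Y)$. It is normal if $N_\varphi+2d\eta\otimes\vec\xi=0$, where $N_\varphi(\vec X,\vec Y)=[\varphi\vec X,\varphi\vec Y]+\varphi^2[\vec X,\vec Y]-\varphi[\varphi\vec X,\vec Y]-\varphi[\vec X,\varphi\vec Y]$. Convention: $d\eta(\vec X,\vec Y)=\tfrac12\big(\vec X\eta(\vec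 Y)-\vec Y\eta(\vec X)-\eta([\vec X,\vec Y])\big)$. Let $D^\perp=\mathrm{span}(\vec\xi)$, so $TX=D\oplus D^\perp$, and let $P:TX\to D$ be the corresponding projection. Let $g$ denote the restriction of $\tilde g$ to $D$ and $\Gamma D$ the module of smooth sections of $D$. An adapted coordinate map is a local chart $(x^1,\dots,x^n)$ of $X$ with $\partial_n=\partial/\partial x^n=\vec\xi$; then $\vec e_a=P(\partial_a)$ ($a=1,\dots,n-1$) is a local frame of $D$, and $\varphi=\varphi^a_b\,\vec e_a\otimes dx^b$. The structure $\varphi$ is quasi-integrable if $\partial_n\varphi^a_b=0$ in adapted coordinates (equivalently $L_{\vec\xi}\varphi=0$). An intrinsic linear connection is a map $\nabla:\Gamma D\times\Gamma D\to\Gamma D$, $(\vec u,\vec v)\mapsto\nabla_{\vec u}\vec v$, that is $C^\infty(X)$-linear in $\vec u$, additive in $\vec v$, and satisfies $\nabla_{\vec u}(f\vec v)=f\nabla_{\vec u}\vec v+(\vec uf)\vec v$. Its torsion is $S(\vec u,\vec v)=\nabla_{\vec u}\vec v-\nabla_{\vec v}\vec u-P[\vec u,\vec v]$. The intrinsic metric connection is the unique intrinsic linear connection with $S=0$ and $\nabla g=0$, i.e. $\vec w\,g(\vec u,\vec v)=g(\nabla_{\vec w}\vec u,\vec v)+g(\vec u,\nabla_{\vec w}\vec v)$ for all $\vec u,\vec v,\vec w\in\Gamma D$. *)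

(* Defs.v *)
From HB Require Import structures.
From mathcomp Require Import all_boot all_order all_algebra.
From mathcomp Require Import all_classical all_reals topology normedtype derive.
From mathcomp Require Import ring.

Set Implicit Arguments.
Unset Strict Implicit.
Unset Printing Implicit Defensive.

Import Order.TTheory GRing.Theory Num.Theory numFieldNormedType.Exports.

Local Open Scope classical_set_scope.
Local Open Scope ring_scope.

Section SmoothEuclidean.
Context {R : realType} {n : nat}.
Implicit Types (U : set 'rV[R]_n) (f g : 'rV[R]_n -> R).

(* All partial derivatives of order at most k exist and are continuous at
   every point of U; only meaningful for U open. *)
Fixpoint Ck_on (k : nat) U f : Prop :=
  (forall x, U x -> {for x, continuous f}) /\
  if k is k'.+1 then
    forall i : 'I_n,
      (forall x, U x -> derivable f x 'e_i) /\ Ck_on k' U ('D_('e_i) f)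
  else True.

Definition smooth_on U f : Prop := forall k, Ck_on k U f.

Lemma Ck_on_ext U f g k : open U -> (forall x, U x -> f x = g x) ->
  Ck_on k U f -> Ck_on k U g.
Proof.
move=> oU; have nearU x h1 h2 : U x -> (forall x, U x -> h1 x = h2 x) ->
    \forall y \near x, h1 y = h2 y :> R.
  by move=> Ux h12; apply: filterS (open_nbhs_nbhs (conj oU Ux)) => y; exact: h12.
have cext h1 h2 : (forall x, U x -> h1 x = h2 x) ->
    (forall x, U x -> {for x, continuous h1}) ->
    (forall x, U x -> {for x, continuous (h2 : 'rV[R]_n -> R)}).
  move=> h12 h1c x Ux.
  have h21 : {near nbhs x, h1 =1 h2} by exact: (nearU x h1 h2 Ux h12).
  rewrite /prop_for /continuous_at -(h12 x Ux).
  exact: cvg_trans (@near_eq_cvg _ _ (nbhs x) _ h1 h2 h21) (h1c x Ux).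
elim: k f g => [|k IH] f g fg [fc H]; split => //; do ?exact: cext fg fc.
move=> i; have [fd Hk] := H i; split=> [x Ux|].
  by apply: near_eq_derivable (fd x Ux); exact: nearU.
by apply: IH Hk => x Ux; apply: near_eq_derive; exact: nearU.
Qed.

Lemma Ck_onW U f k : Ck_on k.+1 U f -> Ck_on k U f.
Proof.
elim: k f => [|k IH] f [fc H]; split => // i.
by have [fd Hk] := H i; split=> //; exact: IH.
Qed.

Lemma Ck_on_cst U (a : R) k : Ck_on k U (cst a).
Proof.
elim: k a => [|k IH] a; first by split=> // x _; exact: cst_continuous.
split => // [x _|i]; first exact: cst_continuous.
split=> [x _|]; first exact: derivable_cst.
suff -> : 'D_('e_i) (cst a : 'rV[R]_n -> R) = cst 0 by exact: IH.
by apply/funext => x; rewrite derive_cst.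
Qed.

Lemma Ck_onD U f g k : open U ->
  Ck_on k U f -> Ck_on k U g -> Ck_on k U (f + g).
Proof.
move=> oU; elim: k f g => [|k IH] f g [fc Hf] [gc Hg];
  (split; first by move=> x Ux; apply: continuousD; [exact: fc|exact: gc]) => // i.
have [fd Hf'] := Hf i; have [gd Hg'] := Hg i; split=> [x Ux|].
  by apply: derivableD; [exact: fd|exact: gd].
apply: Ck_on_ext (IH _ _ Hf' Hg') => // x Ux.
by rewrite deriveD//; [exact: fd|exact: gd].
Qed.

Lemma Ck_onM U f g k : open U ->
  Ck_on k U f -> Ck_on k U g -> Ck_on k U (f * g).
Proof.
move=> oU; elim: k f g => [|k IH] f g Cf Cg.
  by have [fc _] := Cf; have [gc _] := Cg; split=> // x Ux; apply: continuousM;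
    [exact: fc|exact: gc].
have [fc Hf] := Cf; have [gc Hg] := Cg; split=> [x Ux|i].
  by apply: continuousM; [exact: fc|exact: gc].
have [fd Hf'] := Hf i; have [gd Hg'] := Hg i; split=> [x Ux|].
  by apply: derivableM; [exact: fd|exact: gd].
apply: (@Ck_on_ext _ (f * 'D_('e_i) g + g * 'D_('e_i) f)) => // [x Ux|].
  by rewrite deriveM//; [exact: fd|exact: gd].
by apply: Ck_onD => //; apply: IH => //; exact: Ck_onW.
Qed.

End SmoothEuclidean.

(* [chart_inv] inverts [chart_map] on the domain; both are total functions, and
   only their values on [dom] and on its image matter. *)
Record chart (R : realType) (n : nat) (T : topologicalType) := Chart {
  dom : set T;
  chart_map : T -> 'rV[R]_n;
  chart_inv : 'rV[R]_n -> T;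
  open_dom : open dom;
  open_img : open (chart_map @` dom);
  chart_mapK : forall p, dom p -> chart_inv (chart_map p) = p;
  chart_map_continuous : forall p, dom p -> {for p, continuous chart_map};
  chart_inv_continuous :
    forall x, (chart_map @` dom) x -> {for x, continuous chart_inv} }.

Definition img (R : realType) n T (c : chart R n T) : set 'rV[R]_n :=
  chart_map c @` dom c.

Definition smooth_transition (R : realType) n T (c d : chart R n T) : Prop :=
  forall i : 'I_n,
    smooth_on (chart_map c @` (dom c `&` dom d))
              (fun x => chart_map d (chart_inv c x) 0 i).

(* The atlas need not be maximal: smoothness of functions is the same for an
   atlas and for the maximal atlas containing it. *)
Record manifold (R : realType) (n : nat) := Manifold {
  points :> topologicalType;
  atlas : set (chart R n points);
  manifold_hausdorff : hausdorff_space points;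
  manifold_second_countable : @second_countable points;
  atlas_cover : forall p, exists2 c, atlas c & dom c p;
  atlas_compatible : forall c d, atlas c -> atlas d -> smooth_transition c d }.

Section SmoothFunctions.
Context {R : realType} {n : nat} (X : manifold R n).

Definition smooth (f : X -> R) : Prop :=
  forall c, atlas c -> smooth_on (img c) (f \o chart_inv c).

Definition smooth_pred : {pred X -> R} := fun f => `[< smooth f >].

Lemma smooth_cst (a : R) : smooth (cst a).
Proof. by move=> c _ k; exact: Ck_on_cst. Qed.

Lemma smoothD f g : smooth f -> smooth g -> smooth (f + g).
Proof.
move=> fs gs c Ac k.
have -> : (f + g) \o chart_inv c = (f \o chart_inv c) + (g \o chart_inv c) by [].
by apply: Ck_onD; [exact: open_img|exact: fs|exact: gs].
Qed.

Lemma smoothM f g : smooth f -> smooth g -> smooth (f * g).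
Proof.
move=> fs gs c Ac k.
have -> : (f * g) \o chart_inv c = (f \o chart_inv c) * (g \o chart_inv c) by [].
by apply: Ck_onM; [exact: open_img|exact: fs|exact: gs].
Qed.

Lemma smoothZ (a : R) f : smooth f -> smooth (a *: f).
Proof. by move=> fs; exact: (smoothM (smooth_cst a) fs). Qed.

Fact smooth_subring : subring_closed smooth_pred.
Proof.
split=> [|f g /asboolP fs /asboolP gs|f g /asboolP fs /asboolP gs];
  apply/asboolP; [exact: smooth_cst| |exact: smoothM].
by rewrite -scaleN1r; apply: smoothD => //; exact: smoothZ.
Qed.
HB.instance Definition _ :=
  GRing.isSubringClosed.Build (X -> R) smooth_pred smooth_subring.

Fact smooth_scaler : GRing.scaler_closed smooth_pred.
Proof. by move=> a f /asboolP fs; apply/asboolP; exact: smoothZ. Qed.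
HB.instance Definition _ :=
  GRing.isScaleClosed.Build R (X -> R) smooth_pred smooth_scaler.

End SmoothFunctions.
Arguments smooth_pred {R n} X _.

(* The ring C^\infty(X), also an R-module. *)
Record Cinf (R : realType) (n : nat) (X : manifold R n) := MkCinf {
  Cinf_fun :> X -> R;
  Cinf_smooth : Cinf_fun \in smooth_pred X }.

Section CinfRing.
Context {R : realType} {n : nat} (X : manifold R n).
HB.instance Definition _ := [isSub for @Cinf_fun R n X].
HB.instance Definition _ := [Choice of Cinf X by <:].
HB.instance Definition _ :=
  GRing.SubChoice_isSubComPzRing.Build _ _ (Cinf X) (smooth_subring X).
HB.instance Definition _ := [SubZmodule_isSubLmodule of Cinf X by <:].
End CinfRing.

Section VectorFields.
Context {R : realType} {n : nat} (X : manifold R n).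

Definition derivation (v : Cinf X -> Cinf X) : Prop :=
  (forall (a : R) f g, v (a *: f + g) = a *: v f + v g) /\
  (forall f g, v (f * g) = v f * g + f * v g).

Definition derivation_pred : {pred Cinf X -> (Cinf X)^o} :=
  fun v => `[< derivation v >].

Lemma derivation0 : derivation (cst 0).
Proof.
by split=> [a f g|f g]; rewrite ?scaler0 ?addr0// mul0r mulr0 addr0.
Qed.

Lemma Cinf_scaleAr (a : R) (f g : Cinf X) : f * (a *: g) = a *: (f * g).
Proof. by apply/val_inj/funext => p /=; rewrite /GRing.mul/= /GRing.scale/= mulrCA. Qed.

Lemma derivation_lin (h : Cinf X) (v w : Cinf X -> (Cinf X)^o) :
  derivation v -> derivation w -> derivation (h *: v + w).
Proof.
move=> [vl vM] [wl wM]; split=> [a f g|f g].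
  have E u : (h *: v + w) u = h * v u + w u by [].
  by rewrite !E vl wl mulrDr Cinf_scaleAr scalerDr addrACA.
have E u : (h *: v + w) u = h * v u + w u by [].
rewrite !E vM wM mulrDr mulrDl mulrDr !mulrA (mulrC f h) addrACA.
by [].
Qed.

Fact derivation_submod : GRing.submod_closed derivation_pred.
Proof.
split=> [|h v w /asboolP vd /asboolP wd]; apply/asboolP.
  exact: derivation0.
exact: derivation_lin.
Qed.
HB.instance Definition _ :=
  GRing.isSubmodClosed.Build _ (Cinf X -> (Cinf X)^o) derivation_pred
    (GRing.submod_closed_semi derivation_submod).

End VectorFields.
Arguments derivation_pred {R n} X _.

(* Smooth vector fields are the derivations of C^\infty(X); module operations are
   pointwise over C^\infty(X), acting by multiplication. *)
Record vfield (R : realType) (n : nat) (X : manifold R n) := MkVfield {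
  vfield_fun :> Cinf X -> (Cinf X)^o;
  vfield_derivation : vfield_fun \in derivation_pred X }.

Section VfieldModule.
Context {R : realType} {n : nat} (X : manifold R n).
HB.instance Definition _ := [isSub for @vfield_fun R n X].
HB.instance Definition _ := [Choice of vfield X by <:].
HB.instance Definition _ := [SubChoice_isSubLmodule of vfield X by <:].
End VfieldModule.

Section TensorCalculus.
Context {R : realType} {n : nat} {X : manifold R n}.
Implicit Types (u v w : vfield X) (p : X).

Fact lie_bracket_proof v w :
  ((fun f => v (w f) - w (v f)) : Cinf X -> (Cinf X)^o) \in derivation_pred X.
Proof.
have /asboolP[vl vM] := vfield_derivation v.
have /asboolP[wl wM] := vfield_derivation w.
have vD f g : v (f + g) = v f + v g by have := vl 1 f g; rewrite !scale1r.
have wD f g : w (f + g) = w f + w g by have := wl 1 f g; rewrite !scale1r.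
apply/asboolP; split=> [a f g|f g].
  rewrite wl vl vl wl opprD addrACA; congr (_ + _).
  exact/esym/(scalerBr a (v (w f) : Cinf X)).
rewrite vM wM vD wD !vM !wM.
by move: (v (w f)) (w (v f)) (v (w g)) (w (v g)) (v f) (w f) (v g) (w g)
  => *; ring.
Qed.

Definition lie_bracket v w : vfield X := MkVfield (lie_bracket_proof v w).

(* v_p = 0 in T_pX, tangent vectors at p being derivations at p. *)
Definition vanishes_at v p : Prop := forall f : Cinf X, v f p = 0.

(* By C^\infty(X)-linearity and the existence of bump functions, 1-forms and
   tensor fields of type (1,1) are the C^\infty(X)-linear maps on vector
   fields. *)
Definition oneform : Type := {linear vfield X -> (Cinf X)^o}.
Definition tensor11 : Type := {linear vfield X -> vfield X}.

(* No definiteness: the Riemannian and the indefinite case are both covered.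
   Each tangent vector at p is the value at p of a global field, so that
   [pmetric_nondegenerate] is nondegeneracy on every T_pX. *)
Record pseudo_metric := PseudoMetric {
  pmetric :> vfield X -> vfield X -> Cinf X;
  pmetric_sym : forall u v, pmetric u v = pmetric v u;
  pmetric_linear : forall (f : Cinf X) u v w,
    pmetric (f *: u + v) w = f * pmetric u w + pmetric v w;
  pmetric_nondegenerate : forall u p,
    (forall v, pmetric u v p = 0) -> vanishes_at u p }.

Definition ext_deriv (eta : oneform) v w : Cinf X :=
  (2^-1 : R) *: (v (eta w) - w (eta v) - eta (lie_bracket v w) : Cinf X).

Definition nijenhuis (phi : tensor11) v w : vfield X :=
  lie_bracket (phi v) (phi w) + phi (phi (lie_bracket v w))
  - phi (lie_bracket (phi v) w) - phi (lie_bracket v (phi w)).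

Definition lie_derivative (xi : vfield X) (phi : tensor11) v : vfield X :=
  lie_bracket xi (phi v) - phi (lie_bracket xi v).

End TensorCalculus.
Arguments oneform {R n} X.
Arguments tensor11 {R n} X.
Arguments pseudo_metric {R n} X.

Record almost_contact_metric (R : realType) (n : nat) (X : manifold R n) :=
  AlmostContactMetric {
  phi : tensor11 X;
  xi : vfield X;
  eta : oneform X;
  gtilde : pseudo_metric X;
  eta_xi : eta xi = 1;
  phi_xi : phi xi = 0;
  eta_phi : forall v, eta (phi v) = 0;
  phi_phi : forall v, phi (phi v) = - v + eta v *: xi;
  gtilde_phi : forall v w,
    gtilde (phi v) (phi w) = gtilde v w - eta v * eta w }.

Section AlmostContactMetric.
Context {R : realType} {n : nat} {X : manifold R n}.
Context (S : almost_contact_metric X).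
Implicit Types (u v w : vfield X) (p : X).

Definition omega v w : Cinf X := ext_deriv (eta S) v w.

Definition contact_metric : Prop :=
  forall v w, gtilde S v (phi S w) = omega v w.

Definition normal : Prop :=
  forall v w, nijenhuis (phi S) v w + (omega v w *+ 2) *: xi S = 0.

(* L_xi phi = 0, the coordinate-free form of d(phi^a_b)/dx^n = 0 in charts with
   d/dx^n = xi. *)
Definition quasi_integrable : Prop :=
  forall v, lie_derivative (xi S) (phi S) v = 0.

(* Membership in the module of sections of D = ker eta. *)
Definition secD v : Prop := eta S v = 0.

Definition projD v : vfield X := v - eta S v *: xi S.

Definition nondegenerate_on_D : Prop := forall u p,
  secD u -> (forall v, secD v -> omega u v p = 0) -> vanishes_at u p.

Definition ker_omega_is_span_xi : Prop := forall u p,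
  (forall v, omega u v p = 0) <->
  exists c : R, forall f : Cinf X, u f p = c * xi S f p.

(* Only the values of [nabla] on sections of D are constrained, and they lie
   in the module of sections of D. *)
Record intrinsic_connection := IntrinsicConnection {
  nabla :> vfield X -> vfield X -> vfield X;
  nabla_secD : forall u v, secD u -> secD v -> secD (nabla u v);
  nabla_linear : forall (f : Cinf X) u w v, secD u -> secD w -> secD v ->
    nabla (f *: u + w) v = f *: nabla u v + nabla w v;
  nabla_add : forall u v w, secD u -> secD v -> secD w ->
    nabla u (v + w) = nabla u v + nabla u w;
  nabla_leibniz : forall (f : Cinf X) u v, secD u -> secD v ->
    nabla u (f *: v) = f *: nabla u v + (u f : Cinf X) *: v }.

Definition torsion (D : intrinsic_connection) u v : vfield X :=
  D u v - D v u - projD (lie_bracket u v).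

Definition torsion_free (D : intrinsic_connection) : Prop :=
  forall u v, secD u -> secD v -> torsion D u v = 0.

Definition metric_compatible (D : intrinsic_connection) : Prop :=
  forall u v w, secD u -> secD v -> secD w ->
    w (gtilde S u v) = gtilde S (D w u) v + gtilde S u (D w v).

Definition is_intrinsic_metric_connection (D : intrinsic_connection) : Prop :=
  torsion_free D /\ metric_compatible D.

Definition phi_parallel (D : intrinsic_connection) : Prop :=
  forall u v, secD u -> secD v -> D u (phi S v) = phi S (D u v).

End AlmostContactMetric.

(* Main.v *)
Require Import Defs.
From mathcomp Require Import all_boot all_order all_algebra.
From mathcomp Require Import all_classical all_reals topology normedtype derive.
From mathcomp Require Import ring.

Set Implicit Arguments.
Unset Strict Implicit.
Unset Printing Implicit Defensive.

Import GRing.Theory Num.Theory.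
Local Open Scope ring_scope.

(** Let D be ker eta, and let A u v stand for (nabla_u phi) v with u, v in D.

    Splitting every argument of the normality condition along D and xi leaves
    two conditions ([normalP]).  The first has one argument equal to xi: since
    eta = g(., xi) and omega = g(., phi .) force omega(xi, .) = 0, it reads
    phi (L_xi phi) = 0, which is quasi-integrability because L_xi phi takes
    values in D, where phi is injective ([quasi_integrableP]).  The second has
    both arguments u, v in D.  There eta [u, v] = - 2 omega(u, v), so the
    component of N_phi + 2 omega (x) xi along xi vanishes by itself, and only
    the projection to D of N_phi(u, v) has to be zero.

    That projection vanishes exactly when A does ([phi_parallelP]).  As nabla
    has no torsion, it equals
      A (phi u) v - A (phi v) u + phi (A v u) - phi (A u v),
    so A = 0 suffices.  Conversely put a(u, v, w) = g(A u v, w).  Metric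
    compatibility makes a skew in v, w; differentiating phi^2 = - id gives
    a(u, phi v, w) = a(u, v, phi w); and closedness of omega = d eta, which is
    the Jacobi identity in disguise, makes the cyclic sum of a vanish.  These
    three symmetries, the same as in Kaehler geometry, collapse the display
    above to g(N_phi(u, v), w) = - 2 a(w, phi u, v) ([pmetric_nijenhuis]).
    Hence if N_phi has no D-component, a(w, phi u, v) = 0 throughout; phi is
    onto D and g is nondegenerate, so A = 0. *)

(** * Vector fields as derivations, and pseudo-Riemannian metrics *)

(** The values of a vector field and of a 1-form have type (Cinf X)^o.  The
    casts to Cinf X in the lemmas below make the operations those of the
    commutative ring Cinf X, on which [ring] works. *)
Section DerivationCalculus.
Context {R : realType} {n : nat} {X : manifold R n}.
Implicit Types (f g : Cinf X) (u v w : vfield X).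

Lemma Cinf_double_inj f g : f *+ 2 = g *+ 2 -> f = g.
Proof.
move=> /(congr1 (fun h : Cinf X => (2^-1 : R) *: h)).
by rewrite -!scaler_nat !scalerA mulVf ?pnatr_eq0// !scale1r.
Qed.

Lemma vfieldP u v : (forall f, u f = v f) -> u = v.
Proof. by move=> uv; apply/val_inj/funext => f; exact: uv. Qed.

Lemma vfieldDE u v f : (u + v) f = (u f : Cinf X) + v f. Proof. by []. Qed.
Lemma vfieldNE u f : (- u) f = - (u f : Cinf X). Proof. by []. Qed.
Lemma vfieldZE g u f : (g *: u) f = g * (u f : Cinf X). Proof. by []. Qed.
Lemma vfield0E f : (0 : vfield X) f = 0 :> Cinf X. Proof. by []. Qed.

Lemma vfieldM u f g : u (f * g) = (u f : Cinf X) * g + f * (u g : Cinf X).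
Proof. by have /asboolP[_] := vfield_derivation u. Qed.

Lemma vfieldD u f g : u (f + g) = (u f : Cinf X) + u g.
Proof.
have /asboolP[ul _] := vfield_derivation u.
by have := ul 1 f g; rewrite !scale1r.
Qed.

Lemma vfield0 u : u 0 = 0 :> Cinf X.
Proof. by apply: (addrI (u 0)); rewrite -vfieldD !addr0. Qed.

Lemma vfieldN u f : u (- f) = - (u f : Cinf X).
Proof. by apply/eqP; rewrite -addr_eq0 -vfieldD addNr vfield0. Qed.

Lemma vfield1 u : u 1 = 0 :> Cinf X.
Proof.
have := vfieldM u 1 1; rewrite !mulr1 mul1r.
by move=> /(congr1 (+%R^~ (- (u 1 : Cinf X)))); rewrite subrr addrK.
Qed.

Lemma vanishes_everywhere u : (forall p, vanishes_at u p) -> u = 0.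
Proof.
by move=> u0; apply: vfieldP => f; apply/val_inj/funext => p; exact: u0.
Qed.

Lemma lie_bracketE u v f :
  lie_bracket u v f = (u (v f) : Cinf X) - (v (u f) : Cinf X).
Proof. by []. Qed.

Lemma lie_bracketC u v : lie_bracket u v = - lie_bracket v u.
Proof. by apply: vfieldP => f; rewrite vfieldNE !lie_bracketE opprB. Qed.

Lemma lie_bracketDl u v w :
  lie_bracket (u + v) w = lie_bracket u w + lie_bracket v w.
Proof.
apply: vfieldP => f; rewrite vfieldDE !lie_bracketE !vfieldDE vfieldD; ring.
Qed.

Lemma lie_bracketZl f u w :
  lie_bracket (f *: u) w = f *: lie_bracket u w - (w f : Cinf X) *: u.
Proof.
apply: vfieldP => h.
rewrite vfieldDE vfieldNE !vfieldZE !lie_bracketE !vfieldZE vfieldM.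
by ring.
Qed.

Lemma lie_bracket0l w : lie_bracket 0 w = 0.
Proof. by apply: vfieldP => f; rewrite lie_bracketE !vfield0E vfield0 subr0. Qed.

Lemma lie_bracket_jacobi u v w :
  lie_bracket (lie_bracket u v) w + lie_bracket (lie_bracket v w) u
    + lie_bracket (lie_bracket w u) v = 0.
Proof.
apply: vfieldP => f.
by rewrite vfield0E !vfieldDE !lie_bracketE !vfieldD !vfieldN; ring.
Qed.

Section Metric.
Variable g : pseudo_metric X.

Lemma pmetricDl u v w : g (u + v) w = g u w + g v w.
Proof. by rewrite -{1}[u]scale1r pmetric_linear mul1r. Qed.
Lemma pmetric0l w : g 0 w = 0.
Proof. by apply: (addrI (g 0 w)); rewrite -pmetricDl !addr0. Qed.
Lemma pmetricZl f u w : g (f *: u) w = f * g u w.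
Proof. by rewrite -[f *: u]addr0 pmetric_linear pmetric0l addr0. Qed.
Lemma pmetricNl u w : g (- u) w = - g u w.
Proof. by apply/eqP; rewrite -addr_eq0 -pmetricDl addNr pmetric0l. Qed.
Lemma pmetricNr u w : g u (- w) = - g u w.
Proof. by rewrite pmetric_sym pmetricNl pmetric_sym. Qed.

Lemma pmetric_eq0 u : (forall w, g u w = 0) -> u = 0.
Proof.
move=> u0; apply: vanishes_everywhere => p.
by apply: (@pmetric_nondegenerate _ _ _ g) => w; rewrite u0.
Qed.

End Metric.
End DerivationCalculus.

(** * Splitting the normality condition along D and xi *)

Section ContactMetric.
Context {R : realType} {n : nat} {X : manifold R n}.
Variable S : almost_contact_metric X.
Hypothesis contactS : contact_metric S.
Local Notation phi := (phi S).
Local Notation xi := (xi S).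
Local Notation eta := (eta S).
Local Notation g := (gtilde S).
Local Notation omega := (omega S).
Local Notation "[[ u , v ]]" := (lie_bracket u v).
Implicit Types (f : Cinf X) (u v w : vfield X).

(** Compatibility of g with phi against xi, where phi xi = 0. *)
Lemma pmetric_xi v : g v xi = eta v.
Proof.
have := gtilde_phi S v xi.
rewrite phi_xi pmetric_sym pmetric0l eta_xi mulr1 => /esym/eqP.
by rewrite subr_eq0 => /eqP.
Qed.

Lemma etaD u v : eta (u + v) = (eta u : Cinf X) + eta v.
Proof. exact: linearD. Qed.

Lemma etaN v : eta (- v) = - (eta v : Cinf X).
Proof. exact: linearN. Qed.

Lemma etaZ f v : eta (f *: v) = f * (eta v : Cinf X).
Proof. exact: linearZ. Qed.

Lemma phi0 : phi 0 = 0.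
Proof. exact: linear0. Qed.

Lemma phiD u v : phi (u + v) = phi u + phi v.
Proof. exact: linearD. Qed.

Lemma phiN v : phi (- v) = - phi v.
Proof. exact: linearN. Qed.

Lemma phiB u v : phi (u - v) = phi u - phi v.
Proof. exact: linearB. Qed.

Lemma phiZ f v : phi (f *: v) = f *: phi v.
Proof. exact: linearZ. Qed.

Lemma secD_phi v : secD S (phi v).
Proof. exact: eta_phi. Qed.
#[local] Hint Resolve secD_phi : core.

Lemma phi_phi_secD v : secD S v -> phi (phi v) = - v.
Proof. by move=> v0; rewrite phi_phi v0 scale0r addr0. Qed.

Lemma projD_secD v : secD S (projD S v).
Proof. by rewrite /secD etaD etaN etaZ eta_xi mulr1 subrr. Qed.

Lemma phi_projD v : phi (projD S v) = phi v.
Proof. by rewrite phiB phiZ phi_xi scaler0 subr0. Qed.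

Lemma phi_inj_secD v : secD S v -> phi v = 0 -> v = 0.
Proof.
by move=> v0 phiv0; apply/eqP; rewrite -oppr_eq0 -phi_phi_secD// phiv0 phi0.
Qed.

Lemma omega_double v w : omega v w *+ 2
  = (v (eta w) : Cinf X) - (w (eta v) : Cinf X) - (eta [[v, w]] : Cinf X).
Proof.
rewrite /omega /ext_deriv -scaler_nat scalerA mulfV ?pnatr_eq0//.
exact: scale1r.
Qed.

Lemma omegaC v w : omega v w = - omega w v.
Proof.
apply: Cinf_double_inj; rewrite mulNrn !omega_double (lie_bracketC v w) etaN.
by ring.
Qed.

(** The contact condition identifies g(., phi .) with a 2-form, so phi is
    skew-adjoint. *)
Lemma pmetric_phi v w : g (phi v) w = - g v (phi w).
Proof. by rewrite pmetric_sym !contactS omegaC. Qed.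

(** Expands omega(xi, .) = - g(., phi xi) = 0 by the formula for d eta: the flow
    of xi preserves eta. *)
Lemma eta_bracket_xi v : eta [[xi, v]] = xi (eta v).
Proof.
have : omega xi v *+ 2 = 0.
  by rewrite omegaC -contactS phi_xi pmetric_sym pmetric0l oppr0 mul0rn.
rewrite omega_double eta_xi vfield1 subr0 => /eqP.
by rewrite subr_eq0 => /eqP.
Qed.

Lemma eta_bracket_secD u v : secD S u -> secD S v ->
  eta [[u, v]] = - (omega u v *+ 2).
Proof.
by move=> u0 v0; rewrite omega_double u0 v0 !vfield0 subr0 sub0r opprK.
Qed.

Lemma omega_projDl u v : omega (projD S u) v = omega u v.
Proof.
rewrite -!contactS pmetricDl pmetricNl pmetricZl.
by rewrite [g xi _]pmetric_sym pmetric_xi eta_phi mulr0 subr0.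
Qed.

(** The equation d omega = 0 on sections of D.  After doubling, each term
    u (omega v w) becomes - u (eta [v, w]), and the same terms come from
    expanding the right-hand side; the remaining eta [[u, v], w] add up to zero
    by the Jacobi identity. *)
Lemma omega_closed_secD u v w : secD S u -> secD S v -> secD S w ->
  (u (omega v w) : Cinf X) + v (omega w u) + w (omega u v)
  = omega [[u, v]] w + omega [[v, w]] u + omega [[w, u]] v.
Proof.
move=> u0 v0 w0; apply: Cinf_double_inj.
rewrite !mulrnDl !mulr2n -!vfieldD -!mulr2n.
rewrite !omega_double u0 v0 w0 !vfield0 !subr0 !sub0r !vfieldN.
have /(congr1 eta) := lie_bracket_jacobi u v w.
rewrite !etaD [eta 0]linear0 => J.
apply/eqP; rewrite -subr_eq0 -[X in _ == X]J; apply/eqP.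
by ring.
Qed.

Lemma nijenhuisC v w : nijenhuis phi v w = - nijenhuis phi w v.
Proof.
rewrite /nijenhuis (lie_bracketC (phi v)) (lie_bracketC v w).
rewrite (lie_bracketC (phi v) w) (lie_bracketC v) !phiN !opprD !opprK.
by rewrite -!addrA; congr (_ + (_ + _)); rewrite addrC.
Qed.

Lemma nijenhuisDl u v w :
  nijenhuis phi (u + v) w = nijenhuis phi u w + nijenhuis phi v w.
Proof.
rewrite /nijenhuis !phiD !lie_bracketDl !phiD.
apply: vfieldP => f; rewrite !(vfieldDE, vfieldNE); ring.
Qed.

Lemma nijenhuis_xi w : nijenhuis phi xi w = - phi (lie_derivative xi phi w).
Proof.
rewrite /nijenhuis /lie_derivative phi_xi !lie_bracket0l phi0 subr0 add0r.
by rewrite phiB opprB.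
Qed.

(** The terms carrying derivatives of f are multiples of xi, hence killed by
    phi.  This is all the tensoriality of N_phi that the splitting along D and
    xi calls for. *)
Lemma nijenhuisZ_xi f w : nijenhuis phi (f *: xi) w = f *: nijenhuis phi xi w.
Proof.
rewrite /nijenhuis phiZ phi_xi scaler0 !lie_bracket0l phi0 !subr0 !add0r.
rewrite !lie_bracketZl !phiB !phiZ phi_xi !scaler0 phi0 scaler0.
by rewrite !subr0 scalerBr.
Qed.

(** Of the four terms of N_phi only the bracket of phi u and phi v has a
    component along xi, and omega is phi-invariant on D. *)
Lemma eta_nijenhuis u v : secD S u -> secD S v ->
  eta (nijenhuis phi u v) = - (omega u v *+ 2).
Proof.
move=> u0 v0; rewrite /nijenhuis !etaD !etaN !eta_phi !subr0 addr0.
rewrite eta_bracket_secD//.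
by rewrite -!contactS (phi_phi_secD v0) pmetricNr pmetric_phi opprK.
Qed.

(** N_phi(xi, w) = - phi (L_xi phi w), and L_xi phi w lies in D by
    [eta_bracket_xi], where phi is injective. *)
Lemma quasi_integrableP :
  quasi_integrable S <-> forall w, nijenhuis phi xi w = 0.
Proof.
split=> [q w|N0 w]; first by rewrite nijenhuis_xi q phi0 oppr0.
apply: phi_inj_secD; last by apply/eqP; rewrite -oppr_eq0 -nijenhuis_xi N0.
by rewrite /secD etaD etaN eta_bracket_xi !eta_phi vfield0 subr0.
Qed.

(** The component along xi of the normality condition holds automatically on D,
    and the arguments proportional to xi account for quasi-integrability. *)
Lemma normalP : normal S <-> quasi_integrable S /\
  (forall u v, secD S u -> secD S v -> projD S (nijenhuis phi u v) = 0).
Proof.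
have projN u v : secD S u -> secD S v ->
    projD S (nijenhuis phi u v) = nijenhuis phi u v + (omega u v *+ 2) *: xi.
  by move=> u0 v0; rewrite /projD eta_nijenhuis// scaleNr opprK.
split=> [nS|[/quasi_integrableP q N0] v w].
  split=> [|u v u0 v0]; last by rewrite projN.
  apply/quasi_integrableP => w; have := nS xi w.
  rewrite omegaC -contactS phi_xi pmetric_sym pmetric0l oppr0.
  by rewrite mul0rn scale0r addr0.
have decomp u : u = projD S u + eta u *: xi by rewrite /projD subrK.
have Nproj u z : nijenhuis phi u z = nijenhuis phi (projD S u) z.
  by rewrite {1}[u]decomp nijenhuisDl nijenhuisZ_xi q scaler0 addr0.
rewrite Nproj nijenhuisC Nproj -nijenhuisC.
rewrite -[omega v w]omega_projDl omegaC -[omega w _]omega_projDl -omegaC.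
by rewrite -projN ?N0//; exact: projD_secD.
Qed.

(** * The covariant derivative of phi *)

Section MetricConnection.
Variable D : intrinsic_connection S.
Hypotheses (tfD : torsion_free D) (mcD : metric_compatible D).

Definition nabla_phi u v : vfield X := D u (phi v) - phi (D u v).

Lemma nabla_opp u v : secD S u -> secD S v -> D u (- v) = - D u v.
Proof.
move=> u0 v0.
rewrite -scaleN1r nabla_leibniz// vfieldN vfield1 oppr0 scale0r addr0.
by rewrite scaleN1r.
Qed.

Lemma secD_nabla_phi u v : secD S u -> secD S v -> secD S (nabla_phi u v).
Proof.
by move=> u0 v0; rewrite /secD etaD etaN eta_phi subr0 nabla_secD.
Qed.

Lemma nabla_phi_metricE u v w :
  g (nabla_phi u v) w = g (D u (phi v)) w + g (D u v) (phi w).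
Proof. by rewrite pmetricDl pmetricNl pmetric_phi opprK. Qed.

(** The covariant derivative of a skew-adjoint operator is skew-adjoint: apply u
    to g(phi v, w) + g(v, phi w) = 0. *)
Lemma nabla_phi_skew u v w : secD S u -> secD S v -> secD S w ->
  g (nabla_phi u v) w = - g (nabla_phi u w) v.
Proof.
move=> u0 v0 w0; apply/eqP; rewrite -addr_eq0 !nabla_phi_metricE.
have /esym E1 := mcD (secD_phi v) w0 u0.
have /esym E2 := mcD v0 (secD_phi w) u0.
have := vfield0 u; rewrite -(subrr (g v (phi w))) vfieldD addrC.
rewrite -pmetric_phi -E1 -E2 => <-.
rewrite [g (phi v) _]pmetric_sym [g v _]pmetric_sym.
by apply/eqP; ring.
Qed.

(** On D, nabla_u phi anticommutes with phi, by differentiating phi^2 = - id;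
    together with skew-adjointness of phi this moves phi across. *)
Lemma nabla_phi_phi u v w : secD S u -> secD S v -> secD S w ->
  g (nabla_phi u (phi v)) w = g (nabla_phi u v) (phi w).
Proof.
move=> u0 v0 w0; rewrite !nabla_phi_metricE !phi_phi_secD// nabla_opp//.
by rewrite pmetricNl pmetricNr addrC.
Qed.

Lemma omega_bracket u v w : secD S u -> secD S v ->
  omega [[u, v]] w = omega (D u v) w - omega (D v u) w.
Proof.
move=> u0 v0; rewrite -omega_projDl.
have /eqP := tfD u0 v0; rewrite subr_eq0 => /eqP <-.
by rewrite -!contactS pmetricDl pmetricNl.
Qed.

(** g((nabla_u phi) v, w) is - (nabla_u omega)(v, w), and for a torsion-free
    connection the cyclic sum of nabla omega is d omega. *)
Lemma nabla_phi_cyclic u v w : secD S u -> secD S v -> secD S w ->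
  g (nabla_phi u v) w + g (nabla_phi v w) u + g (nabla_phi w u) v = 0.
Proof.
have E a b c : secD S a -> secD S b -> secD S c ->
    g (nabla_phi a b) c
    = omega (D a b) c - omega (D a c) b - (a (omega b c) : Cinf X).
  move=> a0 b0 c0; rewrite nabla_phi_metricE.
  have -> : a (omega b c) = - (g (D a (phi b)) c + g (phi b) (D a c)).
    by rewrite -(mcD (secD_phi b) c0 a0) pmetric_phi contactS vfieldN opprK.
  rewrite [g (phi b) _]pmetric_sym -!contactS; ring.
move=> u0 v0 w0; rewrite !E//; have := omega_closed_secD u0 v0 w0.
rewrite !omega_bracket// => /esym/eqP; rewrite -subr_eq0 => /eqP closed.
rewrite -[RHS]closed; ring.
Qed.

(** Replace every bracket P[a, b] by nabla_a b - nabla_b a, using phi = phi P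
    and phi^2 = - id on D. *)
Lemma projD_nijenhuis u v : secD S u -> secD S v ->
  projD S (nijenhuis phi u v)
  = nabla_phi (phi u) v - nabla_phi (phi v) u
    + phi (nabla_phi v u) - phi (nabla_phi u v).
Proof.
move=> u0 v0.
have pu0 := secD_phi u; have pv0 := secD_phi v.
have bracketE a b : secD S a -> secD S b -> projD S [[a, b]] = D a b - D b a.
  by move=> a0 b0; have /eqP := tfD a0 b0; rewrite subr_eq0 => /eqP.
have phi_bracketE a b : secD S a -> secD S b ->
    phi [[a, b]] = phi (D a b) - phi (D b a).
  by move=> a0 b0; rewrite -phi_projD bracketE// phiB.
have -> : projD S (nijenhuis phi u v) = projD S [[phi u, phi v]]
    + phi (phi [[u, v]]) - phi [[phi u, v]] - phi [[u, phi v]].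
  rewrite /nijenhuis {1}/projD !etaD !etaN !eta_phi !subr0 !addr0 /projD.
  by rewrite -!addrA; congr (_ + _); rewrite !addrA addrC !addrA.
rewrite bracketE// !phi_bracketE// phiB /nabla_phi !phiB.
rewrite !phi_phi_secD; do ?exact: nabla_secD.
apply: vfieldP => f; rewrite !(vfieldDE, vfieldNE); ring.
Qed.

(** Apply the cyclic identity to the two terms whose direction is phi u or
    phi v: all terms differentiated along u or v then cancel by skewness and by
    moving phi across, and the two along w are equal. *)
Lemma pmetric_nijenhuis u v w : secD S u -> secD S v -> secD S w ->
  g (projD S (nijenhuis phi u v)) w = - (g (nabla_phi w (phi u)) v *+ 2).
Proof.
move=> u0 v0 w0; rewrite projD_nijenhuis//.
have pu0 := secD_phi u; have pv0 := secD_phi v.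
have c1 := nabla_phi_cyclic pu0 v0 w0.
have c2 := nabla_phi_cyclic pv0 u0 w0.
have E1 : g (nabla_phi v w) (phi u) = - g (nabla_phi v u) (phi w).
  by rewrite nabla_phi_skew// nabla_phi_phi.
have E2 : g (nabla_phi u w) (phi v) = - g (nabla_phi u v) (phi w).
  by rewrite nabla_phi_skew// nabla_phi_phi.
have E3 : g (nabla_phi w (phi v)) u = - g (nabla_phi w (phi u)) v.
  by rewrite nabla_phi_phi// nabla_phi_skew.
rewrite 3!pmetricDl 2!pmetricNl 2!pmetric_phi.
rewrite -[LHS]addr0 -c2 -[LHS]subr0 -c1 E1 E2 E3.
by ring.
Qed.

(** The converse direction reads off g(A w (phi u), v) = 0 from
    [pmetric_nijenhuis].  Taking phi u for u removes phi, as phi^2 = - id on D,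
    and g(A w u, xi) = eta (A w u) = 0 extends the vanishing to all test
    fields, so nondegeneracy of g applies. *)
Lemma phi_parallelP :
  phi_parallel D <-> forall u v, secD S u -> secD S v ->
    projD S (nijenhuis phi u v) = 0.
Proof.
split=> [par u v u0 v0|N0 u v u0 v0].
  have A0 a b : secD S a -> secD S b -> nabla_phi a b = 0.
    by move=> a0 b0; rewrite /nabla_phi par// subrr.
  by rewrite projD_nijenhuis// !A0// phi0 !subr0 addr0.
have phi_first a b c : secD S a -> secD S b -> secD S c ->
    g (nabla_phi a (phi b)) c = 0.
  move=> a0 b0 c0; apply: Cinf_double_inj; apply: oppr_inj.
  by rewrite -pmetric_nijenhuis// N0// pmetric0l mul0rn oppr0.
have A0 := secD_nabla_phi u0 v0.
have onD w : secD S w -> g (nabla_phi u v) w = 0.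
  move=> w0; apply: oppr_inj; rewrite oppr0 -pmetricNl.
  have <- : nabla_phi u (phi (phi v)) = - nabla_phi u v.
    by rewrite /nabla_phi !phi_phi_secD// !nabla_opp// phiN opprK opprB addrC.
  exact: phi_first.
apply/eqP; rewrite -subr_eq0; apply/eqP/(@pmetric_eq0 _ _ _ g) => w.
rewrite -[D u _ - _]/(nabla_phi u v) -[w](subrK (eta w *: xi)) pmetric_sym.
rewrite pmetricDl pmetric_sym onD; last exact: projD_secD.
by rewrite pmetricZl pmetric_sym pmetric_xi A0 mulr0 addr0.
Qed.

End MetricConnection.
End ContactMetric.

Theorem theorem8 (R : realType) (n : nat) (hn : odd n) (X : manifold R n)
    (S : almost_contact_metric X)
    (hcontact : contact_metric S)
    (hnondeg : nondegenerate_on_D S)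
    (hker : ker_omega_is_span_xi S)
    (D : intrinsic_connection S)
    (hD : is_intrinsic_metric_connection D) :
  normal S <-> (quasi_integrable S /\ phi_parallel D).
Proof.
have [tfD mcD] := hD.
by rewrite normalP// (phi_parallelP hcontact tfD mcD).
Qed.
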